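(* Let $G = (X, Y; E)$ be a connected balanced bipartite graph of order $2n$ with $n \geq 4$, with $e$ edges and minimum degree $\delta \geq 2$. If $\lambda_1 \geq \sqrt{n^2 - 2n + 4}$, where $\lambda_1$ is the largest eigenvalue of the adjacency matrix of $G$, then $G$ is bipancyclic.
   Context: Graphs are finite, undirected, without loops or multiple edges. A bipartite graph $G=(X,Y;E)$ with parts $X$ and $Y$ is balanced if $|X|=|Y|$. A bipartite graph $G$ is bipancyclic if it contains cycles of every even length from $4$ to $|V(G)|$. *)

(* Defs.v *)
From HB Require Import structures.
From mathcomp Require Export all_boot all_order all_algebra.
From mathcomp Require Export reals.

Set Implicit Arguments.
Unset Strict Implicit.
Unset Printing Implicit Defensive.

Import Order.TTheory GRing.Theory Num.Theory.

(* A finite simple graph is a finite vertex type V with an adjacency relation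
   E : rel V that is symmetric and irreflexive. *)

Section Graph.

Variables (V : finType) (E : rel V).

Definition simple_graph : Prop := symmetric E /\ irreflexive E.

Definition edges : {set {set V}} :=
  [set [set p.1; p.2] | p in [pred p : V * V | E p.1 p.2]].

Definition degree (v : V) : nat := #|[set w | E v w]|.

(* Every degree is less than #|V|, so the default value is never reached when V
   is nonempty. *)
Definition min_degree : nat := \big[minn/#|V|]_(v : V) degree v.

Definition connected_graph : Prop := forall u v : V, connect E u v.

Definition bipartition (X Y : {set V}) : Prop :=
  [/\ X :|: Y = [set: V],
      [disjoint X & Y] &
      forall u v : V, E u v ->
        (u \in X /\ v \in Y) \/ (u \in Y /\ v \in X)].

(* [cycle] also accepts sequences of size at most 2, hence the bound on k. *)
Definition has_cycle_of_length (k : nat) : Prop :=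
  2 < k /\ exists2 c : seq V, size c = k & ucycle E c.

Definition bipancyclic : Prop :=
  forall k : nat, 4 <= k <= #|V| -> ~~ odd k -> has_cycle_of_length k.

Definition adjacency_matrix (R : realType) : 'M[R]_#|V| :=
  (\matrix_(i, j) (E (enum_val i) (enum_val j))%:R)%R.

End Graph.

Definition largest_eigenvalue (R : realType) (m : nat) (A : 'M[R]_m) (l : R)
    : Prop :=
  eigenvalue A l /\ forall a : R, eigenvalue A a -> (a <= l)%R.

(* Main.v *)
Require Import Defs.
From mathcomp Require Import all_boot all_order all_algebra.
From mathcomp Require Import reals.
From mathcomp Require Import zify ring lra.

(* Comparing the norms of the two halves of an eigenvector shows lambda1^2 < e
   unless G is complete bipartite, so G lacks at most 2n - 5 edges of K_{n,n}.
   With minimum degree at least 2 this forces a Hamiltonian cycle (Moon-Moser).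
   Deleting a vertex of minimum degree from each side preserves both conditions
   for n - 1, so shorter even cycles follow by induction. *)

Import Order.TTheory GRing.Theory Num.Theory.

Section BipartiteCycles.

Variable V : finType.
Set Implicit Arguments.
Unset Strict Implicit.

Implicit Types (E : rel V) (A B : {set V}).

(** * Non-edges and degrees between two vertex sets *)

Definition independent E A := {in A &, forall u v, ~~ E u v}.

Definition neighbors_in E A v : {set V} := [set w in A | E v w].

Definition min_degree_in E A B d :=
  {in A, forall a, d <= #|neighbors_in E B a|}.

Definition non_edges E A B : nat := \sum_(a in A) \sum_(b in B) ~~ E a b.

(** As [ucycle] admits sequences of size at most 2, this is a genuine Hamiltonian cycle only when
    [A :|: B] has at least three vertices. *)
Definition hamiltonian_on E A B := exists2 c, ucycle E c & c =i A :|: B.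

Lemma hamiltonian_onC E A B : hamiltonian_on E A B -> hamiltonian_on E B A.
Proof. by case=> c Uc cAB; exists c => // v; rewrite setUC. Qed.

Lemma non_edgesC E A B : symmetric E -> non_edges E A B = non_edges E B A.
Proof.
move=> symE; rewrite /non_edges exchange_big.
by apply: eq_bigr => b _; apply: eq_bigr => a _; rewrite symE.
Qed.

Lemma sum_non_edges E B v :
  \sum_(b in B) ~~ E v b = #|B| - #|neighbors_in E B v|.
Proof.
have -> : neighbors_in E B v = B :&: [set w | E v w].
  by apply/setP=> w; rewrite !inE.
rewrite -[in #|B|](cardsID [set w | E v w] B) addKn -sum1_card.
rewrite [LHS](bigID (fun b => E v b)) /= big1 ?add0n => [|b /andP[_ ->] //].
rewrite (eq_bigr (fun=> 1)) => [|b /andP[_ ->] //].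
by apply: eq_bigl => b; rewrite !inE andbC.
Qed.

Lemma neighbors_in_card_le E B v : #|neighbors_in E B v| <= #|B|.
Proof. by apply: subset_leq_card; apply/subsetP=> w; rewrite inE => /andP[]. Qed.

(** * Constructing Hamiltonian cycles *)

Lemma complete_cycle E (s t : seq V) :
    symmetric E -> size s = size t -> {in s & t, forall a b, E a b} ->
  exists2 c, perm_eq c (s ++ t) & cycle E c.
Proof.
move=> symE; elim: s t => [|a s _] [|b t] //=; first by exists [::].
case=> szst Est.
(* The cycle alternates between [s] and [t]. Opening it at [a] gives a statement fit for induction:
   only the start [b] of the path varies. *)
suff [c pc [pathc lastc]] : exists2 c, perm_eq c (s ++ t) &
    path E b c /\ E (last b c) a.
  exists [:: a, b & c].
    rewrite /= perm_cons perm_sym (perm_catCA s [:: b] t) /= perm_cons perm_sym.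
    exact: pc.
  by rewrite /= rcons_path pathc lastc Est ?mem_head.
elim: s t b szst Est => [|a' s IHs] [|b' t] b //= szst Est.
  by exists [::] => //; rewrite symE Est ?mem_head.
case: (IHs t b') => [|u v|c pc [pathc lastc]].
- by case: szst.
- rewrite !inE => us vt; apply: Est; rewrite !inE; last by rewrite vt orbT.
  by case/orP: us => ->; rewrite ?orbT.
exists [:: a', b' & c].
  rewrite /= perm_cons perm_sym (perm_catCA s [:: b'] t) /= perm_cons perm_sym.
  exact: pc.
by rewrite /= pathc lastc symE !Est ?inE ?eqxx ?orbT.
Qed.

(* Some neighbour w of the first vertex x has its predecessor adjacent to the
   last vertex; reversing the path from w on closes it into a cycle. *)
Lemma close_hamiltonian_path E A B x s :
    symmetric E -> independent E B -> uniq (x :: s) -> x :: s =i A :|: B ->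
    path E x s -> x \notin B ->
    #|A| < #|neighbors_in E B x| + #|neighbors_in E A (last x s)| ->
  hamiltonian_on E A B.
Proof.
move=> symE indB Us sAB pathE xB ltA.
set c := x :: s in Us sAB; set y := last x s in ltA.
set P := [set prev c w | w in neighbors_in E B x].
(* As [x] is not in [B], [w] is not the head of [c], so [prev c w] does not wrap around. *)
have split_at w : w \in neighbors_in E B x -> exists q1 q2,
    [/\ s = q1 ++ w :: q2, prev c w = last x q1 & w \in B /\ E x w].
  rewrite inE => /andP[wB Exw].
  have : w \in s.
    have : w \in c by rewrite sAB inE wB orbT.
    rewrite inE => /predU1P[w_x|//].
    by rewrite -w_x wB in xB.
  move=> ws; have cw : w \in c by rewrite inE ws orbT.
  exists (take (index w s) s), (drop (index w s).+1 s).
  rewrite -{2}(nth_index x ws) -drop_nth ?index_mem // cat_take_drop; split=> //.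
  rewrite prev_nth cw /c (last_nth x) size_takel ?index_size //.
  by rewrite -[_ :: take _ _]/(take (index w s).+1 (x :: s)) nth_take.
have PA : P \subset A.
  apply/subsetP=> _ /imsetP[w Nw ->].
  case: (split_at w Nw) => q1 [q2 [def_s -> [wB _]]].
  have : last x q1 \in A :|: B.
    by rewrite -sAB /c def_s -cat_cons mem_cat mem_last.
  rewrite inE => /orP[//|q1B].
  move: pathE; rewrite def_s cat_path /= => /and3P[_ Ew _].
  by have := indB _ _ q1B wB; rewrite Ew.
have cardP : #|P| = #|neighbors_in E B x|.
  by rewrite card_imset //; apply: (can_inj (next_prev Us)).
(* Pigeonhole in [A]: [P] and the neighbours of [y] both lie in [A], and their sizes add up to more
   than [#|A|]. *)
have [w Nw Ey] : exists2 w, w \in neighbors_in E B x & E y (prev c w).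
  apply/exists_inP; apply: contraLR ltA; rewrite negb_exists -leqNgt.
  move/forallP=> noP; rewrite -cardP -cardsUI.
  have -> : P :&: neighbors_in E A y = set0.
    apply/setP=> z; rewrite !inE; apply/negP=> /and3P[/imsetP[w Nw ->] _ Ey].
    by have := noP w; rewrite Nw Ey.
  rewrite cards0 addn0; apply: subset_leq_card; rewrite subUset PA /=.
  by apply/subsetP=> z; rewrite inE => /andP[].
case: (split_at w Nw) => q1 [q2 [def_s def_prev [wB Exw]]].
rewrite def_prev in Ey.
have def_y : y = last w q2 by rewrite /y def_s last_cat.
have pc : perm_eq (x :: q1 ++ rev (w :: q2)) c.
  by rewrite /c perm_cons def_s perm_cat2l perm_rev.
(* The new edges join the end of [q1] to [y], and [w] to [x]. *)
exists (x :: q1 ++ rev (w :: q2)); last by move=> v; rewrite (perm_mem pc) sAB.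
rewrite /ucycle (perm_uniq pc) Us andbT /= rcons_cat cat_path.
move: pathE; rewrite def_s cat_path /= => /and3P[-> _ pq2] /=.
have -> : rcons (rev (w :: q2)) x = y :: rcons (rev (belast w q2)) x.
  by rewrite lastI rev_rcons -def_y.
rewrite /= symE Ey /= rcons_path def_y rev_path.
have -> : path (fun z => E^~ z) w q2 = path E w q2.
  by apply: eq_path => u v; rewrite symE.
rewrite pq2 /=.
have -> : last (last w q2) (rev (belast w q2)) = w.
  have -> : last (last w q2) (rev (belast w q2)) = last w (rev (w :: q2)).
    by rewrite lastI rev_rcons.
  by rewrite rev_cons last_rcons.
by rewrite symE.
Qed.

(* The edges added to E all have the end x, so only the two edges of c at x
   can be missing from E. *)
Lemma hamiltonian_on_add_edge E A B x y :
    symmetric E -> [disjoint A & B] -> independent E A -> independent E B ->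
    #|A| = #|B| -> 1 < #|A| -> x \in A -> y \in B ->
    #|A| < #|neighbors_in E B x| + #|neighbors_in E A y| ->
    hamiltonian_on
      [rel u v | [|| E u v, (u == x) && (v == y) | (u == y) && (v == x)]] A B ->
  hamiltonian_on E A B.
Proof.
move=> symE dAB indA indB eqAB gt1 xA yB ltd [c /andP[cycc Uc] cAB].
have xB : x \notin B by rewrite (disjointFr dAB).
have yA : y \notin A by rewrite (disjointFl dAB).
have /rot_to[i s def_c] : x \in c by rewrite cAB inE xA.
have Us : uniq (x :: s) by rewrite -def_c rot_uniq.
have sAB : x :: s =i A :|: B by move=> v; rewrite -def_c mem_rot cAB.
have szs : 3 < size (x :: s).
  apply: leq_trans (leq_add gt1 gt1) _; rewrite {2}eqAB -cardsUI.
  by rewrite (disjoint_setI0 dAB) cards0 addn0 -(card_uniqP Us) (eq_card sAB).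
move: cycc; rewrite -(rot_cycle i) def_c.
case: s {c Uc cAB def_c} Us sAB szs => [|z s] // Us sAB szs.
have xs : x \notin z :: s by case/andP: Us.
have z_x : z != x by apply: contraNneq xs => <-; rewrite mem_head.
have last_x : last z s != x by apply: contraNneq xs => <-; rewrite mem_last.
rewrite /= rcons_path /= eqxx (negPf z_x) (negPf last_x).
rewrite /= andbF andbT orbF => /and3P[Exz pathE Elast].
have {}pathE : path E z s.
  move: pathE; apply: (@sub_in_path _ (predC1 x)) => [u v|].
    by rewrite !inE => /negPf ux /negPf vx; rewrite /= ux vx andbF !orbF.
  by apply/allP => v vs; apply: contraNneq xs => <-.
(* If the added edge is the first one of the cycle, the rest is a path of [E] from [y] to [x], and
   the closing lemma applies with the sides exchanged. [szs] ensures that the last edge is then not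
   the added one too. *)
have [def_z | z_y] := eqVneq z y.
  have last_y : last z s != y.
    rewrite -def_z; case: (s) Us szs => [|t r] //=.
    by move=> /and3P[_ zr _] _; apply: contraNneq zr => <-; rewrite mem_last.
  rewrite (negPf last_y) orbF in Elast.
  apply: hamiltonian_onC; apply: (@close_hamiltonian_path _ _ _ z (rcons s x)) => //.
  - by rewrite -rcons_cons rcons_uniq -cons_uniq.
  - by move=> v; rewrite -rcons_cons mem_rcons sAB setUC.
  - by rewrite rcons_path pathE.
  - by rewrite def_z.
  - by rewrite last_rcons -eqAB addnC def_z.
rewrite (negPf z_y) orbF in Exz.
case/orP: Elast => [Elast|/eqP def_y]; last first.
  apply: (@close_hamiltonian_path _ _ _ x (z :: s)) => //.
  - by rewrite /= Exz.
  - by rewrite /= def_y.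
by exists (x :: z :: s) => //; rewrite /ucycle Us andbT /= Exz rcons_path pathE.
Qed.

(** * Hamiltonicity from few non-edges *)

(** Each of the at least [k] non-neighbours of [y] in [A] misses at least [#|B| - k] vertices of
    [B]. *)
Lemma non_edges_ge E A B y k :
    (forall a, a \in A -> ~~ E a y -> #|neighbors_in E B a| <= k) ->
    k <= #|[set a in A | ~~ E a y]| ->
  k * (#|B| - k) <= non_edges E A B.
Proof.
move=> degk gek; set S := [set a in A | _] in gek.
apply: (@leq_trans (\sum_(a in S) (#|B| - k))).
  by rewrite sum_nat_const leq_mul2r gek orbT.
rewrite /non_edges [X in _ <= X](big_setID S) /= (setIidPr _); last first.
  by apply/subsetP=> a; rewrite inE => /andP[].
apply: leq_trans (leq_addr _ _); apply: leq_sum => a; rewrite inE => /andP[aA Ea].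
by rewrite sum_non_edges leq_sub2l // degk.
Qed.

Lemma card_non_neighbors E A y :
  symmetric E -> #|[set a in A | ~~ E a y]| = #|A| - #|neighbors_in E A y|.
Proof.
move=> symE; rewrite -sum_non_edges -sum1_card big_mkcond [RHS]big_mkcond.
by apply: eq_bigr => a _; rewrite inE symE; case: (a \in A); case: (E _ _).
Qed.

(** Supplies the decreasing measure for the edge-adding induction. *)
Lemma non_edges_add E A B x y :
    x \in A -> y \in B -> ~~ E x y ->
  non_edges [rel u v | [|| E u v, (u == x) && (v == y) | (u == y) && (v == x)]]
    A B < non_edges E A B.
Proof.
move=> xA yB nE; rewrite /non_edges.
rewrite (big_setD1 x xA) [X in _ < X](big_setD1 x xA) /=.
rewrite (big_setD1 y yB) [X in _ < X + _](big_setD1 y yB) /= !eqxx orbT (negPf nE).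
rewrite add0n -addnA add1n ltnS; apply: leq_add.
  by apply: leq_sum => b _; case: (E _ _); rewrite /= ?leq_b1.
by apply: leq_sum => a _; apply: leq_sum => b _; case: (E _ _); rewrite /= ?leq_b1.
Qed.

(** The difference of the two sides is [(k - 2) * (l - k - 2)]. *)
Lemma mul_sub_ge k l : 1 < k -> 2 * k <= l -> 2 * l - 4 <= k * (l - k).
Proof.
move=> gt1 /subnKC <-; set j := l - _.
have -> : 2 * k + j - k = k + j by lia.
rewrite mulnDr; nia.
Qed.

(* Moon-Moser: among the non-adjacent pairs (x, y) take one with maximal degree
   sum. If the sum exceeds #|A|, the edge xy can be added; otherwise the side of
   the smaller degree k contains k vertices of degree at most k, which forces at
   least k (#|A| - k) >= 2 #|A| - 4 non-edges. *)
Lemma few_non_edges_hamiltonian E A B :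
    symmetric E -> [disjoint A & B] -> independent E A -> independent E B ->
    #|A| = #|B| -> 1 < #|A| ->
    min_degree_in E A B 2 -> min_degree_in E B A 2 ->
    non_edges E A B <= 2 * #|A| - 5 ->
  hamiltonian_on E A B.
Proof.
move: {2}(non_edges E A B).+1 (ltnSn (non_edges E A B)) => m.
elim: m E => // m IHm E lem symE dAB indA indB eqAB gt1 degA degB few.
pose nonadj := [pred p : V * V | [&& p.1 \in A, p.2 \in B & ~~ E p.1 p.2]].
pose dsum (p : V * V) := #|neighbors_in E B p.1| + #|neighbors_in E A p.2|.
case: (pickP nonadj) => [p0 p0P | complete]; last first.
  have [c pc cycc] : exists2 c, perm_eq c (enum A ++ enum B) & cycle E c.
    apply: complete_cycle => // [|a b]; first by rewrite -!cardE.
    rewrite !mem_enum => aA bB; have := complete (a, b).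
    by rewrite /= aA bB /= => /negbFE.
  exists c; last by move=> v; rewrite (perm_mem pc) mem_cat !mem_enum inE.
  rewrite /ucycle cycc (perm_uniq pc) cat_uniq !enum_uniq andbT /=.
  apply/hasPn=> v; rewrite /= !mem_enum => vB; by rewrite (disjointFl dAB).
case: (@arg_maxnP _ p0 nonadj dsum p0P) => -[x y] /and3P[/= xA yB nE] maxp.
case: (ltnP #|A| (dsum (x, y))) => [big | small].
  apply: (@hamiltonian_on_add_edge E A B x y) => //.
  have lt := non_edges_add xA yB nE.
  have xB : x \notin B by rewrite (disjointFr dAB).
  have yA : y \notin A by rewrite (disjointFl dAB).
  apply: IHm => //.
  - exact: leq_trans lt lem.
  - by move=> u v /=; rewrite symE; congr (_ || _); rewrite orbC; congr (_ || _); rewrite andbC.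
  - move=> u v uA vA /=; rewrite (negPf (indA _ _ uA vA)) /= negb_or.
    by apply/andP; split; apply: contra yA => /andP[/eqP eu /eqP ev]; rewrite -?eu -?ev.
  - move=> u v uA vA /=; rewrite (negPf (indB _ _ uA vA)) /= negb_or.
    by apply/andP; split; apply: contra xB => /andP[/eqP eu /eqP ev]; rewrite -?eu -?ev.
  - move=> a aA; apply: leq_trans (degA a aA) _; apply: subset_leq_card.
    by apply/subsetP=> b; rewrite !inE /= => /andP[-> ->].
  - move=> a aA; apply: leq_trans (degB a aA) _; apply: subset_leq_card.
    by apply/subsetP=> b; rewrite !inE /= => /andP[-> ->].
  - by apply: leq_trans few; apply: ltnW.
have dx := degA x xA; have dy := degB y yB.
rewrite /dsum /= in small.
(* If [x] has the smaller degree, then by maximality every non-neighbour of [y] in [A] has degree at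
   most that of [x]. By [small] there are at least that many of them. The other case is
   symmetric. *)
have [lexy | ltyx] := leqP #|neighbors_in E B x| #|neighbors_in E A y|.
  have : #|neighbors_in E B x| * (#|B| - #|neighbors_in E B x|) <= non_edges E A B.
    apply: (@non_edges_ge _ _ _ y) => [a aA Ea|].
      by have := maxp (a, y); rewrite /= aA yB Ea leq_add2r; apply.
    by rewrite card_non_neighbors //; lia.
  have := @mul_sub_ge #|neighbors_in E B x| #|B| dx; lia.
have : #|neighbors_in E A y| * (#|A| - #|neighbors_in E A y|) <= non_edges E B A.
  apply: (@non_edges_ge _ _ _ x) => [a aA Ea|].
    by have := maxp (x, a); rewrite /= aA xA symE Ea leq_add2l; apply.
  by rewrite card_non_neighbors //; lia.
rewrite -(non_edgesC A B symE); have := @mul_sub_ge #|neighbors_in E A y| #|A| dy; lia.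
Qed.

(** * Shorter cycles by deleting a vertex from each side *)

(** The degree in the bipartite complement when [A] is the side opposite to [v], not a number of
    common neighbours. *)
Definition codegree_in E A v : nat := \sum_(w in A) ~~ E v w.

(** A non-edge between [x] and [y] is counted in both codegrees, which the left side corrects. *)
Lemma non_edges_remove E A B x y :
    symmetric E -> x \in A -> y \in B ->
  non_edges E A B + ~~ E x y =
  non_edges E (A :\ x) (B :\ y) + codegree_in E B x + codegree_in E A y.
Proof.
move=> symE xA yB; rewrite /non_edges /codegree_in (big_setD1 x xA) /=.
rewrite [X in _ = _ + X](big_setD1 x xA) /= [E y x]symE.
have -> : \sum_(a in A :\ x) \sum_(b in B) ~~ E a b =
    \sum_(a in A :\ x) (~~ E y a + \sum_(b in B :\ y) ~~ E a b).
  by apply: eq_bigr => a _; rewrite (big_setD1 y yB) /= [E a y]symE.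
rewrite big_split /=; clear; lia.
Qed.

(** Removing the pair lowers the allowance [2 * #|A| - 5] by 2, so it should destroy two non-edges
    or leave none. Vertices of maximal codegree do so unless they are non-adjacent, both of codegree
    1, and some non-edge avoids both; then [y] is exchanged for the end of that non-edge in [B].
    Maximality is recorded to keep the minimum degree. *)
Lemma reducing_pair E A B :
    symmetric E -> A != set0 -> B != set0 ->
  exists x y, [/\ x \in A, y \in B,
    {in A, forall a, codegree_in E B a <= codegree_in E B x},
    {in B, forall b, codegree_in E A b <= codegree_in E A y} &
    non_edges E (A :\ x) (B :\ y) = 0 \/
    non_edges E (A :\ x) (B :\ y) + 2 <= non_edges E A B].
Proof.
move=> symE /set0Pn[x0 x0A] /set0Pn[y0 y0B].
case: (@arg_maxnP _ x0 (mem A) (codegree_in E B) x0A) => x xA maxx.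
case: (@arg_maxnP _ y0 (mem B) (codegree_in E A) y0B) => y yB maxy.
have nonedge_codeg a b : a \in A -> b \in B -> ~~ E a b ->
    0 < codegree_in E B a /\ 0 < codegree_in E A b.
  move=> aA bB nE; rewrite /codegree_in (big_setD1 a aA) (big_setD1 b bB) /=.
  by rewrite [E b a]symE nE.
have [M0 | M'gt0] := posnP (non_edges E (A :\ x) (B :\ y)).
  by exists x, y; split=> //; left.
have [a [b [aA a_x bB b_y nEab]]] :
    exists a b, [/\ a \in A, a != x, b \in B, b != y & ~~ E a b].
  move: M'gt0; rewrite lt0n sum_nat_eq0 negb_forall => /existsP[a].
  rewrite negb_imply => /andP[]; rewrite !inE => /andP[a_x aA].
  rewrite sum_nat_eq0 negb_forall => /existsP[b].
  rewrite negb_imply => /andP[]; rewrite !inE => /andP[b_y bB].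
  by rewrite eqb0 negbK => nE; exists a, b.
have [cdA cdB] := nonedge_codeg a b aA bB nEab.
have cdx := leq_trans cdA (maxx a aA); have cdy := leq_trans cdB (maxy b bB).
have := non_edges_remove symE xA yB.
have [Exy | nExy] := boolP (E x y) => /= defM.
  exists x, y; split=> //; right; move: defM cdx cdy; clear; lia.
have [big | small] := leqP 3 (codegree_in E B x + codegree_in E A y).
  exists x, y; split=> //; right; move: defM big; clear; lia.
(* x misses only y and b has maximal codegree 1, so (x, b) is an edge. *)
have [cdx1 cdy1 cdb1] : [/\ codegree_in E B x = 1, codegree_in E A y = 1
    & codegree_in E A b = 1].
  by have := maxy b bB; move: cdx cdy cdB small => /=; clear; split; lia.
have Exb : E x b.
  move: cdx1; rewrite /codegree_in (big_setD1 y yB) /= nExy add1n => -[] /eqP.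
  rewrite sum_nat_eq0 => /forallP/(_ b); rewrite !inE b_y bB /=.
  by case: (E x b).
exists x, b; split=> // [b' b'B|]; first by rewrite cdb1 -cdy1; apply: maxy.
right; have := non_edges_remove symE xA bB.
by rewrite Exb cdx1 cdb1; clear; lia.
Qed.

(** If [a] dropped below degree 2, it had codegree [#|A| - 2] before, and [x] at least as much.
    Together they would give [2 * #|A| - 4] non-edges. *)
Lemma min_degree_in_remove E A B x y :
    #|A| = #|B| -> 2 < #|A| -> x \in A -> min_degree_in E A B 2 ->
    {in A, forall a, codegree_in E B a <= codegree_in E B x} ->
    non_edges E A B <= 2 * #|A| - 5 ->
  min_degree_in E (A :\ x) (B :\ y) 2.
Proof.
move=> eqAB gt2 xA degA maxx few a /[dup] aAx; rewrite !inE => /andP[a_x aA].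
have le1 : #|neighbors_in E B a| <= #|neighbors_in E (B :\ y) a| + 1.
  have -> : neighbors_in E (B :\ y) a = neighbors_in E B a :\ y.
    by apply/setP=> w; rewrite !inE andbA.
  by rewrite (cardsD1 y (neighbors_in E B a)) addnC leq_add2l leq_b1.
have : codegree_in E B x + codegree_in E B a <= non_edges E A B.
  by rewrite /non_edges (big_setD1 x xA) leq_add2l (big_setD1 a aAx) leq_addr.
move: (maxx a aA) (degA a aA) le1 few gt2.
by rewrite /codegree_in !sum_non_edges eqAB; clear; lia.
Qed.

Lemma few_non_edges_cycles E A B k :
    symmetric E -> [disjoint A & B] -> independent E A -> independent E B ->
    #|A| = #|B| -> min_degree_in E A B 2 -> min_degree_in E B A 2 ->
    non_edges E A B <= 2 * #|A| - 5 -> 1 < k <= #|A| ->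
  exists2 c, size c = 2 * k & ucycle E c.
Proof.
move def_m: #|A| => m symE.
elim: m A B def_m => [|m IHm] A B cardA dAB indA indB cardB degA degB few.
  by case/andP=> /leq_trans-/[apply].
case/andP=> gt1; rewrite leq_eqVlt => /predU1P[def_k | lt_k].
  have [|||c Uc cAB] := @few_non_edges_hamiltonian E A B symE dAB indA indB _ _ degA degB.
  - by rewrite cardA.
  - by rewrite cardA -def_k.
  - by rewrite cardA.
  exists c => //; case/andP: Uc => _ Uc.
  rewrite -(card_uniqP Uc) (eq_card cAB) cardsU (disjoint_setI0 dAB) cards0.
  by rewrite cardA -cardB def_k subn0 mul2n addnn.
have gt2 : 2 < #|A| by rewrite cardA; apply: leq_trans lt_k.
have eqAB : #|A| = #|B| by rewrite cardA.
have [||x [y [xA yB maxx maxy red]]] := @reducing_pair E A B symE.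
- by rewrite -card_gt0 cardA.
- by rewrite -card_gt0 -cardB.
have cardA' : #|A :\ x| = m by move: (cardsD1 x A); rewrite xA cardA => -[].
have cardB' : #|B :\ y| = m by move: (cardsD1 y B); rewrite yB -cardB => -[].
have sub_disj : [disjoint A :\ x & B :\ y].
  apply: disjointWl (subsetDl _ _) _; apply: disjointWr (subsetDl _ _) _; exact: dAB.
apply: (IHm (A :\ x) (B :\ y)) => //.
- by move=> u v; rewrite !inE => /andP[_ uA] /andP[_ vA]; apply: indA.
- by move=> u v; rewrite !inE => /andP[_ uA] /andP[_ vA]; apply: indB.
- by apply: min_degree_in_remove => //; rewrite cardA.
- by apply: min_degree_in_remove; rewrite -?eqAB // -non_edgesC // cardA.
(* Count and allowance both drop by 2. For [#|A| = 3] the allowance only falls from 1 to 0 by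
   truncation, but then two non-edges cannot be lost and the first case holds. *)
- by case: red few => [->|] //; clear; lia.
- by rewrite gt1.
Qed.

End BipartiteCycles.

(** * Comparing an eigenvalue with the number of edges *)

Section SpectralBound.

Set Implicit Arguments.
Unset Strict Implicit.
Local Open Scope ring_scope.

Variables (R : realType) (V : finType) (E : rel V).

(** [eigenvalue] concerns row vectors, hence the sum over [u] with [E u w]. *)
Lemma eigenvalue_adjacencyP (l : R) : eigenvalue (adjacency_matrix E R) l ->
  exists2 f : V -> R, (exists v, f v != 0) &
    forall w, \sum_(u | E u w) f u = l * f w.
Proof.
case/eigenvalueP=> v eqv nzv; exists (fun u => v 0 (enum_rank u)).
  case/rV0Pn: nzv => i nzi; exists (enum_val i); by rewrite enum_valK.
move=> w; have /rowP/(_ (enum_rank w)) := eqv; rewrite !mxE => <-.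
rewrite [LHS](reindex (fun i : 'I_#|V| => enum_val i)) /=; last exact/onW_bij/enum_val_bij.
rewrite big_mkcond; apply: eq_bigr => i _; rewrite !mxE enum_rankK enum_valK.
by case: (E _ _); rewrite ?mulr1 ?mulr0.
Qed.

(* For x in X, l * f x is the sum of f over the d(x) neighbours of x. With mu
   their mean, d(x) * sum_Y f^2 - (l * f x)^2 is d(x) times the sum of f^2 over
   the non-neighbours and of (f - mu)^2 over the neighbours. Summing over x gives
   l^2 <= sum d(x); in the equality case f is constant on the neighbours of x
   and vanishes elsewhere, for every x. *)
Lemma eigenvalue_sqr_lt_edges (X Y : {set V}) (l : R) :
    symmetric E -> bipartition E X Y ->
    (forall v, 0 < degree E v)%N -> 0 < l ->
    eigenvalue (adjacency_matrix E R) l ->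
  l ^+ 2 < (\sum_(x in X) #|neighbors_in E Y x|)%:R \/
  {in X & Y, forall x y, E x y}.
Proof.
move=> symE [XYT dXY bip] deg_gt0 l_gt0 /eigenvalue_adjacencyP[f [v0 nz] eigf].
have nX u v : E u v -> u \in X -> v \in Y.
  move=> /bip[[]//|[uY vX] uX]; by rewrite (disjointFr dXY uX) in uY.
have nY u v : E u v -> v \in Y -> u \in X.
  move=> /bip[[]//|[uY vX] vY]; by rewrite (disjointFr dXY vX) in vY.
have fX x : x \in X -> \sum_(y in Y | E x y) f y = l * f x.
  move=> xX; rewrite -eigf; apply: eq_bigl => y; rewrite symE.
  by case Eyx: (E y x); rewrite ?andbF // andbT (nX x) // symE.
have fY y : y \in Y -> \sum_(x in X | E x y) f x = l * f y.
  move=> yY; rewrite -eigf; apply: eq_bigl => x.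
  by case Exy: (E x y); rewrite ?andbF // andbT (nY _ _ Exy).
pose S := \sum_(y in Y) f y ^+ 2.
(* Multiplied by [l], both sides equal the sum of [f x * f y] over all edges. *)
have SX : \sum_(x in X) f x ^+ 2 = S.
  apply: (mulfI (lt0r_neq0 l_gt0)); rewrite /S !mulr_sumr.
  transitivity (\sum_(x in X) \sum_(y in Y | E x y) f x * f y).
    by apply: eq_bigr => x xX; rewrite -mulr_sumr fX // expr2 mulrCA.
  rewrite (exchange_big_dep (mem Y)) /=; last by move=> x y _ /andP[].
  apply: eq_bigr => y yY; rewrite expr2 mulrA -fY // mulr_suml.
  by apply: eq_bigl => x; rewrite yY.
have [y0 y0Y nzy0] : exists2 y, y \in Y & f y != 0.
  apply/exists_inP; apply: contraNT nz; rewrite negb_exists => /forallP f0.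
  have S0 : S = 0.
    apply: big1 => y yY; have := f0 y; rewrite yY /= negbK => /eqP ->.
    by rewrite expr0n.
  have : v0 \in X :|: Y by rewrite XYT.
  rewrite inE => /orP[vX | vY]; last by have := f0 v0; rewrite vY /= negbK.
  move: SX; rewrite S0 => /psumr_eq0P-/(_ (fun _ _ => sqr_ge0 _)) /(_ _ vX) /eqP.
  by rewrite sqrf_eq0.
have S_gt0 : 0 < S.
  rewrite /S (bigD1 y0) //= ltr_wpDr ?sumr_ge0 // => [*|]; first exact: sqr_ge0.
  by rewrite exprn_even_gt0.
pose d x := #|neighbors_in E Y x|.
have d_gt0 x : x \in X -> (0 < d x)%N.
  move=> xX; apply: leq_trans (deg_gt0 x) _; apply: subset_leq_card.
  by apply/subsetP=> w; rewrite !inE => Exw; rewrite Exw (nX x).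
pose mu x := l * f x / (d x)%:R.
pose g x y := if E x y then f y - mu x else f y.
have defD x : x \in X ->
    (d x)%:R * S - (l * f x) ^+ 2 = (d x)%:R * \sum_(y in Y) g x y ^+ 2.
  move=> xX; have dx0 : (d x)%:R != 0 :> R by rewrite pnatr_eq0 -lt0n d_gt0.
  rewrite /S (bigID (E x)) [in RHS](bigID (E x)) /=.
  have -> : \sum_(y in Y | ~~ E x y) g x y ^+ 2 = \sum_(y in Y | ~~ E x y) f y ^+ 2.
    by apply: eq_bigr => y /andP[_ /negPf nE]; rewrite /g nE.
  have -> : \sum_(y in Y | E x y) g x y ^+ 2 =
     \sum_(y in Y | E x y) f y ^+ 2 - (l * f x) ^+ 2 / (d x)%:R.
    rewrite (eq_bigr (fun y => f y ^+ 2 - (2 * mu x * f y - mu x ^+ 2))); last first.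
      by move=> y /andP[_ Exy]; rewrite /g Exy; ring.
    rewrite sumrB sumrB -mulr_sumr fX // sumr_const.
    have -> : #|[pred y | (y \in Y) && E x y]| = d x.
      by apply: eq_card => y; rewrite !inE.
    by rewrite -mulr_natl /mu; field.
  by field.
have g_ge0 x : 0 <= \sum_(y in Y) g x y ^+ 2 by apply: sumr_ge0 => *; apply: sqr_ge0.
have [|le_e] := ltP (l ^+ 2) (\sum_(x in X) d x)%:R; [by left | right].
(* By [defD] and [SX] the sum is [(\sum_(x in X) d x - l ^+ 2) * S], which [le_e] makes
   nonpositive. *)
have sum0 : \sum_(x in X) (d x)%:R * \sum_(y in Y) g x y ^+ 2 = 0.
  apply: le_anti; rewrite sumr_ge0 ?andbT => [|x _]; last by rewrite mulr_ge0.
  rewrite -(eq_bigr _ defD) sumrB -mulr_suml -natr_sum.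
  under [X in _ - X]eq_bigr => x _ do rewrite exprMn.
  by rewrite -mulr_sumr SX -mulrBl pmulr_lle0 // subr_le0.
have g0 x y : x \in X -> y \in Y -> g x y = 0.
  move=> xX yY; move: sum0 => /psumr_eq0P/(_ x xX) gx0.
  have /eqP := gx0 (fun _ _ => mulr_ge0 (ler0n _ _) (g_ge0 _)).
  rewrite mulf_eq0 pnatr_eq0 -leqn0 leqNgt d_gt0 //= => /eqP.
  move/psumr_eq0P => /(_ (fun _ _ => sqr_ge0 _)) /(_ _ yY) /eqP.
  by rewrite sqrf_eq0 => /eqP.
(* A vertex of [Y] where [f] is nonzero must be adjacent to all of [X], so all means agree. *)
have adj0 x : x \in X -> E x y0 /\ mu x = f y0.
  move=> xX; have := g0 x y0 xX y0Y; rewrite /g.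
  case: (E x y0) => [/subr0_eq-> //|fy0]; by rewrite fy0 eqxx in nzy0.
move=> x y xX yY; have := g0 x y xX yY; rewrite /g.
case: (E x y) => // fy0.
(* A non-edge at [y] gives [f y = 0], but [y] has a neighbour [x'], whose mean [f y0] is nonzero. *)
have /card_gt0P[x'] := deg_gt0 y; rewrite inE symE => Ex'y.
have x'X := nY _ _ Ex'y yY.
have := g0 x' y x'X yY; rewrite /g Ex'y (adj0 x' x'X).2 fy0 sub0r => /eqP.
by rewrite oppr_eq0 (negPf nzy0).
Qed.

End SpectralBound.

(** * From the spectral condition to the edge count and all even cycles *)

Lemma bigminn_le (I : eqType) (s : seq I) (F : I -> nat) (m : nat) (i : I) :
  i \in s -> \big[minn/m]_(j <- s) F j <= F i.
Proof.
elim: s => // j s IHs; rewrite inE big_cons => /predU1P[-> | /IHs le_s].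
  exact: geq_minl.
by apply: leq_trans le_s; apply: geq_minr.
Qed.

Theorem theorem1 (R : realType) (V : finType) (E : rel V) (X Y : {set V})
    (n e : nat) (lambda1 : R)
    (hG : simple_graph E)
    (hbip : bipartition E X Y)
    (hbal : #|X| = #|Y|)
    (hconn : connected_graph E)
    (hord : #|V| = (2 * n)%N)
    (hn : (4 <= n)%N)
    (he : #|edges E| = e)
    (hdelta : (2 <= min_degree E)%N)
    (hlambda1 : largest_eigenvalue (adjacency_matrix E R) lambda1)
    (hspec : (Num.sqrt (n%:R ^+ 2 - 2 * n%:R + 4) <= lambda1)%R) :
  bipancyclic E.
Proof.
have [symE _] := hG; have [XYT dXY bip] := hbip.
have deg2 v : 1 < degree E v.
  by apply: leq_trans hdelta _; apply: bigminn_le; rewrite mem_index_enum.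
have cardX : #|X| = n.
  apply/eqP; rewrite -(eqn_pmul2l (isT : 0 < 2)) -hord mul2n -addnn {2}hbal.
  by rewrite -cardsT -XYT cardsU (disjoint_setI0 dXY) cards0 subn0.
have indX : independent E X.
  move=> u v uX vX; apply/negP=> /bip[[_ vY]|[uY _]].
    by rewrite (disjointFr dXY vX) in vY.
  by rewrite (disjointFr dXY uX) in uY.
have indY : independent E Y.
  move=> u v uY vY; apply/negP=> /bip[[uX _]|[_ vX]].
    by rewrite (disjointFr dXY uX) in uY.
  by rewrite (disjointFr dXY vX) in vY.
have degX : min_degree_in E X Y 2.
  move=> x xX; apply: leq_trans (deg2 x) (subset_leq_card _).
  apply/subsetP=> y; rewrite !inE => Exy; rewrite Exy andbT.
  have : y \in X :|: Y by rewrite XYT.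
  by rewrite inE => /orP[yX|//]; have := indX x y xX yX; rewrite Exy.
have degY : min_degree_in E Y X 2.
  move=> x xY; apply: leq_trans (deg2 x) (subset_leq_card _).
  apply/subsetP=> y; rewrite !inE => Exy; rewrite Exy andbT.
  have : y \in X :|: Y by rewrite XYT.
  by rewrite inE => /orP[//|yY]; have := indY x y xY yY; rewrite Exy.
have few : non_edges E X Y <= 2 * #|X| - 5.
  have nR : (4 <= n%:R :> R)%R by rewrite ler_nat.
  have rad_ge0 : (0 < n%:R ^+ 2 - 2 * n%:R + 4 :> R)%R by nra.
  have l_gt0 : (0 < lambda1)%R by apply: lt_le_trans hspec; rewrite sqrtr_gt0.
  have le_l2 : (n%:R ^+ 2 - 2 * n%:R + 4 <= lambda1 ^+ 2)%R.
    by rewrite -(sqr_sqrtr (ltW rad_ge0)) lerXn2r ?nnegrE ?sqrtr_ge0 // ltW.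
  have := eigenvalue_sqr_lt_edges symE hbip (fun v => ltnW (deg2 v)) l_gt0 hlambda1.1.
  case=> [lt_e | complete]; last first.
    rewrite /non_edges big1 // => x xX; rewrite big1 // => y yY.
    by rewrite complete.
  have sum_e : non_edges E X Y + \sum_(x in X) #|neighbors_in E Y x| = n * n.
    rewrite /non_edges -big_split /= -{1}cardX -sum_nat_const; apply: eq_bigr => x xX.
    by rewrite sum_non_edges subnK ?neighbors_in_card_le // -hbal.
  have := le_lt_trans le_l2 lt_e; set e' := \sum_(x in X) _ in sum_e *.
  (* Adding [2 * n] clears the subtraction before the inequality passes to [nat]:
     [n * n + 4 < e' + 2 * n], hence fewer than [2 * n - 4] non-edges by [sum_e]. *)
  rewrite -natrX -natrM -(ltrD2r (2 * n)%:R%R).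
  have -> : ((n ^ 2)%:R - (2 * n)%:R + 4 + (2 * n)%:R = (n * n + 4)%:R :> R)%R.
    by rewrite natrD -mulnn; ring.
  rewrite -natrD ltr_nat -sum_e cardX; clear -hn; lia.
move=> k /andP[k4 kV] /even_halfK def_k; split; first exact: leq_trans k4.
have lek : 1 < k./2 <= #|X|.
  by rewrite -leq_double -[k./2 <= _]leq_double def_k k4 cardX -mul2n -hord.
have [c szc Uc] :=
  few_non_edges_cycles symE dXY indX indY hbal degX degY few lek.
by exists c; rewrite // szc mul2n def_k.
Qed.
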